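(* Let $M$ be a compact Kähler manifold of real dimension $2$ (complex dimension $1$) and let $S=\bigoplus_{l\ge 0}E_l$ be a bundle of symplectic spinors on $M$. Then for every $l\ge 0$ the symplectic Dolbeault operator $\bar{\mathscr D}|_{E_l}:\Gamma(E_l)\to\Gamma(E_{l+1})$ is elliptic, and for every $l\ge 1$ the symplectic Dolbeault operator $\mathscr D|_{E_l}:\Gamma(E_l)\to\Gamma(E_{l-1})$ is elliptic.
   Context: $(M^{2n},g,J,\omega)$ is a compact Kähler manifold (here $n=1$), with $g(v,w)=\omega(v,Jw)$. A local unitary frame is a local orthonormal frame $\{a_j,b_j=Ja_j\}_{j=1}^n$ with $\omega(a_i,b_j)=\delta_{ij}$, $\omega(a_i,a_j)=\omega(b_i,b_j)=0$. The canonical quantization of a symplectic vector space with symplectic basis $\{a_j,b_j\}$ is the action on (a suitable domain in) $L^2(\mathbb R^n)$ given by $\sigma(a_j)=ix_j$, $\sigma(b_j)=\partial/\partial x_j$, so that $[\sigma(v),\sigma(w)]=-i\omega(v,w)$. A bundle of symplectic spinors is a complex vector bundle $S\to M$ with a Hermitian metric, a Hermitian connection $\nabla^S$, and a smoothly varying action $\sigma$ of tangent vectors (extended complex-linearly to $TM\otimes\mathbb C$) which on each fibre is isomorphic to the canonical quantization representation for $(T_xM,\omega_x)$ (or possibly to a dense subrepresentation), such that $\langle\sigma(v)\psi,\phi\rangle=-\langle\psi,\sigma(v)\phi\rangle$ for real $v$, and $\nabla^S_w(\sigma(v)\psi)=\sigma(\nabla_wv)\psi+\sigma(v)\nabla^S_w\psi$,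 where $\nabla$ is the Levi-Civita connection. The operator $H=\frac12\sum_j(\sigma(a_j)^2+\sigma(b_j)^2)$ is independent of the unitary frame, and $S=\bigoplus_{l\ge0}E_l$, where $E_l$ is the eigenbundle of $H$ with eigenvalue $-(l+n/2)$, of rank $\binom{n+l-1}{l}$; $\nabla^S$ preserves each $E_l$. The symplectic Dirac operators are, in a local unitary frame, $D=\sum_j(\sigma(a_j)\nabla^S_{b_j}-\sigma(b_j)\nabla^S_{a_j})$ and $\tilde D=\sum_j(\sigma(a_j)\nabla^S_{a_j}+\sigma(b_j)\nabla^S_{b_j})$. The symplectic Dolbeault operators are $\mathscr D=D+i\tilde D$ and $\bar{\mathscr D}=D-i\tilde D$. *)

(* Defs.v *)
From HB Require Import structures.
From mathcomp Require Import all_boot all_order all_algebra.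
From mathcomp Require Import all_classical all_reals all_analysis.
From mathcomp Require Import complex.
Import Order.TTheory GRing.Theory Num.Theory.
Import numFieldNormedType.Exports.

Set Implicit Arguments.
Unset Strict Implicit.
Unset Printing Implicit Defensive.

Local Open Scope classical_set_scope.
Local Open Scope ring_scope.

Definition linear_on (K : pzRingType) (V W : lmodType K) (A : set V)
    (h : V -> W) : Prop :=
  forall (c : K) u v, A u -> A v -> h (c *: u + v) = c *: h u + h v.

(** * Smooth manifolds *)

Fixpoint Ck (R : realType) (m k : nat) (V : set 'rV[R]_m)
    (f : 'rV[R]_m -> R) : Prop :=
  (forall u, V u -> {for u, continuous f}) /\
  (if k is k'.+1 then
     forall i : 'I_m,
       (forall u, V u -> derivable f u (delta_mx 0 i)) /\
       Ck k' V ('D_(delta_mx 0 i) f)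
   else True).

Definition Cinfty (R : realType) (m : nat) (V : set 'rV[R]_m)
    (f : 'rV[R]_m -> R) : Prop :=
  forall k, Ck k V f.

Record chart (R : realType) (m : nat) (X : topologicalType) := Chart {
  dom : set X;
  coord : X -> 'rV[R]_m;
  cinv : 'rV[R]_m -> X;
  dom_open : open dom;
  coord_open : open (coord @` dom);
  coordK : {in dom, cancel coord cinv};
  coord_cts : forall x, dom x -> {for x, continuous coord};
  cinv_cts : forall u, (coord @` dom) u -> {for u, continuous cinv}
}.

Record manifold (R : realType) (m : nat) := Manifold {
  pt :> topologicalType;
  atlas : set (chart R m pt);
  pt_hausdorff : hausdorff_space pt;
  pt_second_countable : @second_countable pt;
  atlas_cover : forall x : pt, exists2 c, atlas c & dom c x;
  atlas_compatible : forall c c', atlas c -> atlas c' -> forall i : 'I_m,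
    Cinfty (coord c @` (dom c `&` dom c'))
           (fun u => coord c' (cinv c u) ord0 i)
}.

Section Calculus.
Variables (R : realType) (m : nat) (M : manifold R m).

(* [f] is smooth in a neighbourhood of [x]. *)
Definition smooth_at (f : M -> R) (x : M) : Prop :=
  forall c, atlas c -> dom c x ->
  exists V : set 'rV[R]_m,
    [/\ open V, V (coord c x), V `<=` coord c @` dom c
      & Cinfty V (f \o cinv c)].

Definition csmooth_at (f : M -> R[i]) (x : M) : Prop :=
  smooth_at (fun y => complex.Re (f y)) x /\
  smooth_at (fun y => complex.Im (f y)) x.

(* Tangent vectors are derivations of germs of smooth functions.  They are
   represented as functionals on all functions, with the value 0 on those that
   are not smooth near the base point, so that equal derivations are equal as
   functionals. *)
Definition vec := (M -> R) -> R.

Definition tangent (x : M) : set vec := [set v : vec |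
  [/\ forall f, ~ smooth_at f x -> v f = 0,
      forall f g, smooth_at f x -> (\forall y \near x, f y = g y) -> v f = v g,
      forall (c : R) f g, smooth_at f x -> smooth_at g x ->
        v (fun y => c * f y + g y) = c * v f + v g
    & forall f g, smooth_at f x -> smooth_at g x ->
        v (fun y => f y * g y) = v f * g x + f x * v g]].

Definition cder (v : vec) (f : M -> R[i]) : R[i] :=
  (v (fun y => complex.Re (f y)) +i* v (fun y => complex.Im (f y)))%C.

(* [X] is a smooth vector field in a neighbourhood of [x]. *)
Definition field_at (X : M -> vec) (x : M) : Prop :=
  \forall y \near x, tangent y (X y) /\
    forall f, smooth_at f y -> smooth_at (fun z => X z f) y.

Definition lie (X Y : M -> vec) (x : M) : vec := fun f =>
  if `[< smooth_at f x >]
  then X x (fun y => Y y f) - Y x (fun y => X y f) else 0.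

End Calculus.

(** * Kaehler surfaces *)

(* The bilinearity, smoothness and nondegeneracy of [form] follow from
   [met_form]. *)
Record kahler (R : realType) (M : manifold R 2) := Kahler {
  met : M -> vec M -> vec M -> R;
  cplx : M -> vec M -> vec M;
  form : M -> vec M -> vec M -> R;
  met_linear : forall x v, tangent x v -> linear_on (tangent x) (met x v);
  met_sym : forall x v w, tangent x v -> tangent x w -> met x v w = met x w v;
  met_pos : forall x v, tangent x v -> v <> 0 -> 0 < met x v v;
  met_smooth : forall x X Y, field_at X x -> field_at Y x ->
    smooth_at (fun y => met y (X y) (Y y)) x;
  cplx_tangent : forall x v, tangent x v -> tangent x (cplx x v);
  cplx_linear : forall x, linear_on (tangent x) (cplx x);
  cplx_sq : forall x v, tangent x v -> cplx x (cplx x v) = - v;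
  cplx_smooth : forall x X, field_at X x -> field_at (fun y => cplx y (X y)) x;
  (* vanishing of the Nijenhuis tensor *)
  cplx_integrable : forall x X Y, field_at X x -> field_at Y x ->
    let J Z := fun y => cplx y (Z y) in
    lie X Y x + cplx x (lie (J X) Y x) + cplx x (lie X (J Y) x)
      - lie (J X) (J Y) x = 0;
  form_skew : forall x v w, tangent x v -> tangent x w ->
    form x v w = - form x w v;
  (* d form = 0 *)
  form_closed : forall x X Y Z, field_at X x -> field_at Y x -> field_at Z x ->
    X x (fun y => form y (Y y) (Z y)) - Y x (fun y => form y (X y) (Z y))
    + Z x (fun y => form y (X y) (Y y))
    - form x (lie X Y x) (Z x) + form x (lie X Z x) (Y x)
    - form x (lie Y Z x) (X x) = 0;
  met_form : forall x v w, tangent x v -> tangent x w ->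
    met x v w = form x v (cplx x w)
}.

(* [nab x v Y] is the covariant derivative at [x] of the field [Y] (smooth
   near [x]) along the tangent vector [v]. *)
Record levi_civita (R : realType) (M : manifold R 2) (K : kahler M)
    (nab : M -> vec M -> (M -> vec M) -> vec M) : Prop := LeviCivita {
  lc_tangent : forall x v Y, tangent x v -> field_at Y x ->
    tangent x (nab x v Y);
  lc_linear : forall x Y, field_at Y x ->
    linear_on (tangent x) (fun v => nab x v Y);
  lc_add : forall x v Y Z, tangent x v -> field_at Y x -> field_at Z x ->
    nab x v (fun y => Y y + Z y) = nab x v Y + nab x v Z;
  lc_leibniz : forall x v f Y, tangent x v -> smooth_at f x -> field_at Y x ->
    nab x v (fun y => f y *: Y y) = v f *: Y x + f x *: nab x v Y;
  lc_local : forall x v Y Z, tangent x v -> field_at Y x ->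
    (\forall y \near x, Y y = Z y) -> nab x v Y = nab x v Z;
  lc_smooth : forall x X Y, field_at X x -> field_at Y x ->
    field_at (fun y => nab y (X y) Y) x;
  lc_metric : forall x v Y Z, tangent x v -> field_at Y x -> field_at Z x ->
    v (fun y => met K y (Y y) (Z y)) =
    met K x (nab x v Y) (Z x) + met K x (Y x) (nab x v Z);
  lc_torsion : forall x X Y, field_at X x -> field_at Y x ->
    nab x (X x) Y - nab x (Y x) X = lie X Y x
}.

(* A unitary basis [a, b = J a] of the tangent space at [x]; by [met_form] and
   [form_skew] it is orthonormal, and form(a, b) = 1. *)
Definition unitary_basis (R : realType) (M : manifold R 2) (K : kahler M)
    (x : M) (a b : vec M) : Prop :=
  [/\ tangent x a, b = cplx K x a, met K x a a = 1
    & forall v, tangent x v -> exists p q : R, v = p *: a + q *: b].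

(** * The canonical quantization, on the domain of Schwartz functions *)

Section CanonicalQuantization.
Variable R : realType.

Definition real_schwartz (h : R -> R) : Prop :=
  (forall k t, derivable (h^`(k)%classic) t 1) /\
  (forall j k : nat, exists B, forall t, `|t ^+ j * (h^`(k)%classic) t| <= B).

Definition schwartz (f : R -> R[i]) : Prop :=
  real_schwartz (fun t => complex.Re (f t)) /\
  real_schwartz (fun t => complex.Im (f t)).

Definition quant_a (f : R -> R[i]) : R -> R[i] :=
  fun t => 'i%C * (t%:C)%C * f t.

Definition quant_b (f : R -> R[i]) : R -> R[i] :=
  fun t => ((fun u => complex.Re (f u))^`()%classic t +i*
            (fun u => complex.Im (f u))^`()%classic t)%C.

Definition L2_sqdist (f h : R -> R[i]) : \bar R :=
  (\int[@lebesgue_measure R]_t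
     ((complex.Re (f t - h t)) ^+ 2 + (complex.Im (f t - h t)) ^+ 2)%:E)%E.

(* Schwartz space is itself dense in L^2, so density in it for the L^2 norm is
   the same as density in L^2. *)
Definition dense_subrep (F : set (R -> R[i])) : Prop :=
  [/\ F `<=` schwartz,
      forall (c : R[i]) f h, F f -> F h -> F (c *: f + h),
      forall f, F f -> F (quant_a f) /\ F (quant_b f)
    & forall f (eps : R), schwartz f -> 0 < eps ->
        exists2 h, F h & (L2_sqdist f h < eps%:E)%E].

End CanonicalQuantization.

(** * Bundles, differential operators, ellipticity *)

(* A complex bundle given by its fibres and its sheaf of smooth sections:
   [smooth_sec x s] means that [s] is a smooth section in a neighbourhood
   of [x].  Local triviality is required below, for spinor bundles. *)
Record bundle (R : realType) (M : manifold R 2) := Bundle {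
  fib :> M -> lmodType R[i];
  smooth_sec : M -> (forall y, fib y) -> Prop;
  sec_near : forall x s, smooth_sec x s -> \forall y \near x, smooth_sec y s;
  sec_local : forall x s t, smooth_sec x s ->
    (\forall y \near x, s y = t y) -> smooth_sec x t;
  sec_add : forall x s t, smooth_sec x s -> smooth_sec x t ->
    smooth_sec x (fun y => s y + t y);
  sec_scale : forall x f s, csmooth_at f x -> smooth_sec x s ->
    smooth_sec x (fun y => f y *: s y)
}.

Section Elliptic.
Variables (R : realType) (M : manifold R 2) (S : bundle M).
Implicit Types (E F : forall x, set (S x)) (s t : forall x, S x).

(* [s] is, in a neighbourhood of [x], a smooth section of [S] with values
   in [E]. *)
Definition section_at E (x : M) s : Prop :=
  smooth_sec x s /\ \forall y \near x, E y (s y).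

Definition rscale (f : M -> R) s : forall x, S x :=
  fun y => ((f y)%:C)%C *: s y.

Definition commutator (P : (forall x, S x) -> forall x, S x) (f : M -> R) s :
  forall x, S x := fun y => P (rscale f s) y - ((f y)%:C)%C *: P s y.

(* A linear differential operator of order at most one from sections of [E]
   to sections of [F].  Being stated for germs, this covers the sections over
   every open set, in particular the global ones. *)
Definition diffop1 (P : (forall x, S x) -> forall x, S x) E F : Prop :=
  forall x s, section_at E x s ->
  [/\ section_at F x (P s),
      forall t, (\forall y \near x, s y = t y) -> P s x = P t x,
      forall (c : R[i]) t, section_at E x t ->
        P (fun y => c *: s y + t y) x = c *: P s x + P t x
    & forall f g, smooth_at f x -> smooth_at g x ->
        commutator P f (rscale g s) x = ((g x)%:C)%C *: commutator P f s x].

(* The graph of the principal symbol of a first-order operator at the covector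
   [xi] at [x]: s(x) |-> P(f s)(x), where f(x) = 0 and df_x = xi. *)
Definition principal_symbol (P : (forall x, S x) -> forall x, S x) E
    (x : M) (xi : vec M -> R) (e e' : S x) : Prop :=
  exists f s,
    [/\ smooth_at f x, f x = 0, forall v, tangent x v -> v f = xi v,
        section_at E x s & s x = e /\ P (rscale f s) x = e'].

Definition elliptic (P : (forall x, S x) -> forall x, S x) E F : Prop :=
  diffop1 P E F /\
  forall (x : M) (xi : vec M -> R),
    linear_on (tangent x) xi -> (exists2 v, tangent x v & xi v <> 0) ->
    exists A : S x -> S x,
      [/\ linear_on (E x) A, set_bij (E x) (F x) A
        & forall e e', principal_symbol P E xi e e' <-> E x e /\ e' = A e].

End Elliptic.

(** * Bundles of symplectic spinors *)

Record spinor_bundle (R : realType) (M : manifold R 2) (K : kahler M)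
    (nab : M -> vec M -> (M -> vec M) -> vec M) := SpinorBundle {
  spb :> bundle M;
  herm : forall x, spb x -> spb x -> R[i];
  act : forall x, vec M -> spb x -> spb x;
  nabS : forall x, vec M -> (forall y, spb y) -> spb x;

  herm_linear : forall x (c : R[i]) (p q r : spb x),
    herm (c *: p + q) r = c * herm p r + herm q r;
  herm_conj : forall x (p q : spb x), herm q p = conjc (herm p q);
  herm_pos : forall x (p : spb x), p <> 0 -> 0 < herm p p;
  herm_smooth : forall x s t, smooth_sec x s -> smooth_sec x t ->
    csmooth_at (fun y => herm (s y) (t y)) x;

  nabS_linear_vec : forall x (c : R) v w s, tangent x v -> tangent x w ->
    smooth_sec x s ->
    nabS x (c *: v + w) s = (c%:C)%C *: nabS x v s + nabS x w s;
  nabS_add : forall x v s t, tangent x v -> smooth_sec x s -> smooth_sec x t ->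
    nabS x v (fun y => s y + t y) = nabS x v s + nabS x v t;
  nabS_leibniz : forall x v f s, tangent x v -> csmooth_at f x ->
    smooth_sec x s ->
    nabS x v (fun y => f y *: s y) = cder v f *: s x + f x *: nabS x v s;
  nabS_local : forall x v s t, tangent x v -> smooth_sec x s ->
    (\forall y \near x, s y = t y) -> nabS x v s = nabS x v t;
  nabS_smooth : forall x X s, field_at X x -> smooth_sec x s ->
    smooth_sec x (fun y => nabS y (X y) s);
  nabS_herm : forall x v s t, tangent x v -> smooth_sec x s -> smooth_sec x t ->
    cder v (fun y => herm (s y) (t y)) =
    herm (nabS x v s) (t x) + herm (s x) (nabS x v t);

  act_linear_vec : forall x (c : R) v w (p : spb x), tangent x v ->
    tangent x w -> act (c *: v + w) p = (c%:C)%C *: act v p + act w p;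
  act_linear : forall x v (c : R[i]) (p q : spb x), tangent x v ->
    act v (c *: p + q) = c *: act v p + act v q;
  act_skew : forall x v (p q : spb x), tangent x v ->
    herm (act v p) q = - herm p (act v q);
  act_smooth : forall x X s, field_at X x -> smooth_sec x s ->
    smooth_sec x (fun y => act (X y) (s y));
  act_nabS : forall x w X s, tangent x w -> field_at X x -> smooth_sec x s ->
    nabS x w (fun y => act (X y) (s y)) =
    act (nab x w X) (s x) + act (X x) (nabS x w s);

  (* Near each point, [Phi] identifies the fibres, as representations of the
     tangent spaces, with a dense subrepresentation [F] of the canonical
     quantization attached to a smooth unitary frame; sections which are
     constant in this trivialization are smooth. *)
  spb_local : forall x, exists (a b : M -> vec M) (F : set (R -> R[i]))
      (Phi : forall y, spb y -> R -> R[i]),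
    [/\ field_at a x, field_at b x, dense_subrep F,
        (\forall y \near x,
          [/\ unitary_basis K y (a y) (b y),
              linear_on setT (Phi y),
              set_bij setT F (Phi y),
              forall p, Phi y (act (a y) p) = quant_a (Phi y p)
            & forall p, Phi y (act (b y) p) = quant_b (Phi y p)])
      & forall f s, F f -> (\forall y \near x, Phi y (s y) = f) ->
          smooth_sec x s]
}.

Section Dirac.
Variables (R : realType) (M : manifold R 2) (K : kahler M).
Variables (nab : M -> vec M -> (M -> vec M) -> vec M).
Variable S : spinor_bundle K nab.

(* The operators below do not depend on the unitary frame; one is chosen at
   each point. *)
Definition frame (x : M) : vec M * vec M :=
  xget (0, 0) [set ab : vec M * vec M | unitary_basis K x ab.1 ab.2].

Definition hamiltonian (x : M) (p : S x) : S x :=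
  let: (a, b) := frame x in
  (2%:R^-1 : R[i]) *: (act a (act a p) + act b (act b p)).

Definition eigenbundle (l : nat) (x : M) : set (S x) :=
  [set p | hamiltonian p = (- (l%:R + 2%:R^-1) : R[i]) *: p].

(* S is the Hilbert sum of the eigenbundles; the algebraic direct sum is the
   case of exact finite expansions. *)
Definition spinor_decomposition : Prop :=
  forall (x : M) (p : S x) (eps : R), 0 < eps ->
  exists (N : nat) (e : nat -> S x),
    (forall l, eigenbundle l (e l)) /\
    let r := p - \sum_(l < N) e l in herm r r < (eps%:C)%C.

Definition dirac (s : forall x, S x) : forall x, S x := fun x =>
  let: (a, b) := frame x in act a (nabS x b s) - act b (nabS x a s).

Definition dirac_tilde (s : forall x, S x) : forall x, S x := fun x =>
  let: (a, b) := frame x in act a (nabS x a s) + act b (nabS x b s).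

Definition dolbeault (s : forall x, S x) : forall x, S x := fun x =>
  dirac s x + 'i%C *: dirac_tilde s x.

Definition dolbeault_bar (s : forall x, S x) : forall x, S x := fun x =>
  dirac s x - 'i%C *: dirac_tilde s x.

End Dirac.

Arguments eigenbundle {R M K nab} S l x _ : rename.
Arguments dolbeault {R M K nab} S s x : rename.
Arguments dolbeault_bar {R M K nab} S s x : rename.

(* Main.v *)
Require Import Defs.
From mathcomp Require Import all_boot all_order all_algebra.
From mathcomp Require Import all_classical all_reals all_analysis.
From mathcomp Require Import complex ring lra.
Import Order.TTheory GRing.Theory Num.Theory.
Import numFieldNormedType.Exports.

(** Let [j] be one of the two square roots of -1 and consider [D + j D~], which
is the first Dolbeault operator for [j = i] and the second one for [j = -i].
In a unitary frame [a], [b = J a] it factors as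
  [D + j D~ = L_j (nabla_b + j nabla_a)]   with   [L_j = act a + j act b].
Rotating the frame multiplies [L_j] by a complex number of modulus one and the
other factor by its inverse, so the product is the same for every frame
([twisted_dirac_frame]); since smooth frames exist locally, the operator is
smooth, and the Leibniz rule shows that its symbol at a covector [xi] is
  [(xi(b) + j xi(a)) L_j]
([twisted_dirac_rscale]).  The scalar vanishes for no nonzero real covector, so
everything reduces to the ladder operator [L_j].

The relation [act a act b - act b act a = -i] gives
  [L_j L_(-j) = 2 H + j i]
([ladder_product_hamiltonian]).  By associativity of [L_j L_(-j) L_j], the
operator [L_j] maps the eigenspace of [H] for [lambda] to that for
[lambda - j i] ([ladder_eigen]), and there [L_(-j)] inverts it up to the scalar
[2 lambda - j i].  For [lambda = -(l + 1/2)] this scalar is [-2 (l + 1)] when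
[j = -i] and [-2 l] when [j = i], whence the condition [1 <= l] in the second
case.

The operator takes sections of eigenbundles to sections of eigenbundles because
the connection preserves the latter ([nabS_eigen]): a unitary frame has
derivatives [nabla_v a = q b], [nabla_v b = -q a], so the commutators of
[nabla_v] with [L_j] and [L_(-j)] are opposite multiples of these operators and
cancel in [L_j L_(-j)].

Finally the symbol has to be defined on all of the eigenspace and at all
covectors.  Tangent vectors being derivations of germs, linearly independent
ones are independent as functionals, so smooth functions with prescribed
differential exist by linear algebra ([differential_onto]); and an eigenvector
extends to a section of the eigenbundle that is constant in a local
trivialization ([spinor_extension]). *)

Set Implicit Arguments.
Unset Strict Implicit.
Unset Printing Implicit Defensive.

Local Open Scope classical_set_scope.
Local Open Scope ring_scope.

(** * Linear algebra *)

Lemma double_eq0 (V : zmodType) (z : V) : z = z + z -> z = 0.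
Proof. by move/eqP; rewrite -subr_eq0 opprD addNKr oppr_eq0 => /eqP. Qed.

Lemma mulCii (R : realType) : 'i%C * 'i%C = -1 :> R[i].
Proof. by rewrite -expr2 sqr_i. Qed.

(** Factorization of a sum of two squares by a square root of -1: it makes the
scalars appearing in frame rotations invertible, and the symbol nonzero. *)
Lemma sum_sq_factor (R : realType) (j : R[i]) (p q : R) : j * j = -1 ->
  (p%:C%C - j * q%:C%C) * (p%:C%C + j * q%:C%C) = (p * p + q * q)%:C%C.
Proof.
move=> jj; rewrite raddfD/= !rmorphM/=; set P := p%:C%C; set Q := q%:C%C.
by transitivity (P * P - j * j * (Q * Q)); [ring|rewrite jj; ring].
Qed.

Section LinearOn.
Variables (K : pzRingType) (V W : lmodType K) (A : set V) (h : V -> W).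
Hypotheses (lh : linear_on A h) (A0 : A 0).

Lemma linear_on0 : h 0 = 0.
Proof. by have := lh (-1) A0 A0; rewrite !scaleN1r !addNr. Qed.

Lemma linear_onZ c v : A v -> h (c *: v) = c *: h v.
Proof. by move=> Av; have := lh c Av A0; rewrite linear_on0 !addr0. Qed.

End LinearOn.

(** * Smooth functions and tangent vectors *)

Section Smooth.
Variables (R : realType) (m : nat).
Implicit Types (V W : set 'rV[R]_m) (f g : 'rV[R]_m -> R).

(** Openness of [V] matters: derivatives at points of [V] then depend only on
the values on [V]. *)
Lemma Ck_eq V f g k : open V -> {in V, f =1 g} -> Ck k V f -> Ck k V g.
Proof.
move=> oV; elim: k f g => [|k IH] f g fg [cf df].
all: have nfg u : V u -> \forall z \near u, f z = g z
  by move=> Vu; apply: filterS (open_nbhs_nbhs (conj oV Vu)) => z Vz;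
     apply/fg/mem_set.
all: have cg u : V u -> {for u, continuous g}
  by move=> Vu; rewrite /prop_for /continuous_at -(fg u (mem_set Vu));
     apply: cvg_trans (cf u Vu); apply: near_eq_cvg (nfg u Vu).
  by split.
split=> // i; have [dfi Cfi] := df i; split=> [u Vu|].
  by apply: near_eq_derivable (dfi u Vu); exact: nfg.
by apply: IH Cfi => u /set_mem Vu; apply: near_eq_derive; exact: nfg.
Qed.

Lemma Ck_sub V W f k : W `<=` V -> Ck k V f -> Ck k W f.
Proof.
move=> WV; elim: k f => [|k IH] f [cf df]; split=> //.
- by move=> u /WV/cf.
- by move=> u /WV/cf.
- move=> i; have [dfi Cfi] := df i.
  by split=> [u /WV/dfi//|]; exact: IH.
Qed.

Lemma Ck_lin V f g (c : R) k : open V -> Ck k V f -> Ck k V g ->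
  Ck k V (fun u => c * f u + g u).
Proof.
move=> oV; elim: k f g => [|k IH] f g [cf df] [cg dg].
all: have cfg u : V u -> {for u, continuous (fun u => c * f u + g u)}
  by move=> Vu; apply: cvgD (cg u Vu); apply: cvgM (cf u Vu); exact: cvg_cst.
  by split.
split=> // i; have [dfi Cfi] := df i; have [dgi Cgi] := dg i; split=> [u Vu|].
  by have := derivableD (@derivableZ _ _ _ _ c _ _ (dfi u Vu)) (dgi u Vu).
apply: Ck_eq (IH _ _ Cfi Cgi) => // u /set_mem Vu.
have cdf := @derivableZ _ _ _ _ c _ _ (dfi u Vu).
by have := deriveD cdf (dgi u Vu); rewrite (deriveZ c (dfi u Vu)).
Qed.

Lemma Ck_cst V (c : R) k : Ck k V (fun=> c).
Proof.
elim: k c => [|k IH] c; split=> //; do ?by move=> u _; exact: cst_continuous.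
move=> i; split=> [u Vu|]; first exact: derivable_cst.
rewrite (_ : 'D__ _ = fun=> 0); first exact: IH.
by apply/funext => u; exact: derive_cst.
Qed.

Variable M : manifold R m.

Lemma smooth_at_cst (c : R) (x : M) : smooth_at (fun=> c) x.
Proof.
move=> ch _ xch; exists (Defs.coord ch @` dom ch); split=> //.
- exact: coord_open.
- by move=> k; exact: Ck_cst.
Qed.

Lemma smooth_at_lin (c : R) (f g : M -> R) (x : M) :
  smooth_at f x -> smooth_at g x -> smooth_at (fun y => c * f y + g y) x.
Proof.
move=> sf sg ch ach xch.
have [V [oV Vx Vd CV]] := sf ch ach xch; have [W [oW Wx _ CW]] := sg ch ach xch.
exists (V `&` W); split=> //.
- exact: openI.
- by move=> u [/Vd].
- move=> k; apply: Ck_lin; first exact: openI.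
  + by apply: Ck_sub (CV k) => u [].
  + by apply: Ck_sub (CW k) => u [].
Qed.

Lemma csmooth_at_real (f : M -> R) (x : M) :
  smooth_at f x -> csmooth_at (fun y => (f y)%:C%C) x.
Proof. by move=> sf; split=> //=; exact: smooth_at_cst. Qed.

Lemma csmooth_at_cst (c : R[i]) (x : M) : csmooth_at (fun=> c) x.
Proof. by split; exact: smooth_at_cst. Qed.

End Smooth.

Section Tangent.
Variables (R : realType) (m : nat) (M : manifold R m).
Implicit Types (x : M) (v w : vec M).

Lemma tangent_cst x v (c : R) : tangent x v -> v (fun=> c) = 0.
Proof.
move=> [_ _ vlin vM].
have s1 := @smooth_at_cst _ _ M 1 x; have s0 := @smooth_at_cst _ _ M 0 x.
have v1 : v (fun=> 1) = 0.
  have /= := vM _ _ s1 s1; rewrite !mulr1 mul1r.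
  exact: double_eq0.
have v0 : v (fun=> 0) = 0.
  by have /= := vlin (-1) _ _ s1 s1; rewrite v1 mulr0 addr0 mulr1 addNr.
by have /= := vlin c _ _ s1 s0; rewrite v1 v0 mulr0 mulr1 !addr0.
Qed.

Lemma tangent_near_cst x v (f : M -> R) (c : R) : tangent x v ->
  (\forall y \near x, f y = c) -> v f = 0.
Proof.
move=> vx fc; have [_ vloc _ _] := vx.
rewrite -(tangent_cst c vx); symmetry; apply: vloc; first exact: smooth_at_cst.
by apply: filterS fc.
Qed.

Lemma tangent_lin x (c : R) v w :
  tangent x v -> tangent x w -> tangent x (c *: v + w).
Proof.
move=> [v0 vloc vlin vM] [w0 wloc wlin wM].
have E f : (c *: v + w) f = c * v f + w f by [].
split.
- by move=> f nf; rewrite E v0// w0// mulr0 addr0.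
- by move=> f g sf fg; rewrite !E (vloc _ _ sf fg) (wloc _ _ sf fg).
- by move=> k f g sf sg; rewrite !E vlin// wlin//; ring.
- by move=> f g sf sg; rewrite !E vM// wM//; ring.
Qed.

Lemma tangent0 x : tangent x (0 : vec M).
Proof.
split=> //.
- by move=> k f g _ _; rewrite mulr0 addr0.
- by move=> f g _ _; rewrite mul0r mulr0 addr0.
Qed.

Lemma tangentZ x (c : R) v : tangent x v -> tangent x (c *: v).
Proof.
by move=> vx; rewrite -[_ *: _]addr0; exact: tangent_lin (tangent0 x).
Qed.

(** A nonzero tangent vector does not vanish on all smooth functions, since it
is 0 on the others.  Apply this to [v], which gives a function [f1], and to the
combination of [v] and [w] that kills [f1]: the two functions obtained have an
invertible matrix of derivatives. *)
Lemma differential_onto x v w (alpha beta : R) : tangent x v -> tangent x w ->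
  v <> 0 -> (forall c, w <> c *: v) ->
  exists f, [/\ smooth_at f x, f x = 0, v f = alpha & w f = beta].
Proof.
move=> vx wx v0 wv.
have nz u : tangent x u -> u <> 0 -> exists2 f, smooth_at f x & u f != 0.
  move=> [u0 _ _ _] /eqP un0; apply: contrapT => nf; move/eqP: un0; apply.
  apply/funext => f; have [sf|/u0//] := pselect (smooth_at f x).
  by apply: contrapT => /eqP uf; apply: nf; exists f.
have [f1 s1 vf1] := nz v vx v0.
have [|f2 s2 wf2] := nz (- (w f1 / v f1) *: v + w) (tangent_lin _ vx wx).
  by move/eqP; rewrite addrC scaleNr subr_eq0 => /eqP /wv.
have {}wf2 : v f1 * w f2 - w f1 * v f2 != 0.
  apply: contra wf2 => /eqP E; apply/eqP.
  transitivity (- (w f1 / v f1) * v f2 + w f2) => //.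
  transitivity ((v f1)^-1 * (v f1 * w f2 - w f1 * v f2)); first by field.
  by rewrite E mulr0.
(* Cramer's rule *)
set d := v f1 * w f2 - w f1 * v f2 in wf2.
pose c1 := (alpha * w f2 - beta * v f2) / d.
pose c2 := (beta * v f1 - alpha * w f1) / d.
have sk k := @smooth_at_cst _ _ M k x.
pose k := - (c1 * f1 x + c2 * f2 x).
have s2k : smooth_at (fun y => c2 * f2 y + k) x by exact: smooth_at_lin.
have E u : tangent x u ->
    u (fun y => c1 * f1 y + (c2 * f2 y + k)) = c1 * u f1 + c2 * u f2.
  move=> ux; have [_ _ ulin _] := ux.
  by rewrite ulin// ulin// (tangent_cst _ ux) addr0.
exists (fun y => c1 * f1 y + (c2 * f2 y + k)); split.
- exact: smooth_at_lin.
- by rewrite /k; ring.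
- by rewrite E// /c1 /c2 /d; field.
- by rewrite E// /c1 /c2 /d; field.
Qed.
End Tangent.

(** * Unitary frames *)

Section UnitaryFrames.
Variables (R : realType) (M : manifold R 2) (K : kahler M).
Implicit Types (x : M) (a b u v w : vec M) (p q : R).

Lemma metDr x (c : R) u v w : tangent x u -> tangent x v -> tangent x w ->
  met K x u (c *: v + w) = c * met K x u v + met K x u w.
Proof. by move=> ux vx wx; exact: (met_linear K ux c vx wx). Qed.

Lemma metDl x (c : R) u v w : tangent x u -> tangent x v -> tangent x w ->
  met K x (c *: v + w) u = c * met K x v u + met K x w u.
Proof.
move=> ux vx wx; have vw := tangent_lin c vx wx.
by rewrite (met_sym K vw ux) (met_sym K vx ux) (met_sym K wx ux) metDr.
Qed.

Lemma metNr x u v : tangent x u -> tangent x v ->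
  met K x u (- v) = - met K x u v.
Proof.
move=> ux vx.
rewrite -scaleN1r (linear_onZ (met_linear K ux) (tangent0 x) _ vx).
exact: mulN1r.
Qed.

Lemma metZr x (c : R) u v : tangent x u -> tangent x v ->
  met K x u (c *: v) = c * met K x u v.
Proof.
by move=> ux vx; exact: (linear_onZ (met_linear K ux) (tangent0 x) _ vx).
Qed.

(** Orthonormality comes from the skew-symmetry of the Kaehler form, which makes
[J] an isometry and [J a] orthogonal to [a]. *)
Lemma unitary_met x a b : unitary_basis K x a b ->
  [/\ tangent x a, tangent x b,
      met K x a a = 1, met K x b b = 1 & met K x a b = 0].
Proof.
move=> [ax -> a1 _]; have Jx := cplx_tangent K ax.
have JJx := cplx_tangent K Jx; split=> //.
  rewrite (met_form K Jx Jx) (form_skew K Jx JJx) -(met_form K JJx ax).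
  by rewrite (met_sym K JJx ax) cplx_sq// metNr// a1 opprK.
have Nx : tangent x (- cplx K x a) by rewrite -scaleN1r; exact: tangentZ.
have JN : cplx K x (- cplx K x a) = a.
  rewrite -scaleN1r (linear_onZ (cplx_linear K (x := x)) (tangent0 x) _ Jx).
  by rewrite cplx_sq// scaleN1r opprK.
have faa : Defs.form K x a a = 0.
  by have := form_skew K ax ax; lra.
apply/eqP; rewrite -oppr_eq0 -metNr//.
by rewrite (met_form K ax Nx) JN faa.
Qed.

Lemma met_coord x a b p q : unitary_basis K x a b ->
  met K x (p *: a + q *: b) a = p /\ met K x (p *: a + q *: b) b = q.
Proof.
move=> uab; have [ax bx aa bb ab] := unitary_met uab.
have ba : met K x b a = 0 by rewrite (met_sym K bx ax).
have qx := tangentZ q bx.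
have mZ u : tangent x u -> met K x (q *: b) u = q * met K x b u.
  by move=> ux; rewrite (met_sym K qx ux) (met_sym K bx ux) metZr.
by rewrite !metDl// !mZ// aa bb ab ba !mulr0 !mulr1 addr0 add0r.
Qed.

Lemma unitary_indep x a b : unitary_basis K x a b ->
  a <> 0 /\ forall c : R, b <> c *: a.
Proof.
move=> uab; have [ax bx aa bb ab] := unitary_met uab; split=> [a0|c bca].
  have [+ _] := met_coord 1 0 uab.
  rewrite a0 scaler0 add0r scale0r (linear_on0 (met_linear K (tangent0 x)))//.
    by move/esym/eqP; rewrite oner_eq0.
  exact: tangent0.
have [_ E1] := met_coord c 0 uab; have [_ E2] := met_coord 0 1 uab.
move: E2; rewrite scale0r scale1r add0r {1}bca.
move: E1; rewrite scale0r addr0 => -> /esym/eqP.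
by rewrite oner_eq0.
Qed.

Lemma unitary_change x a b a' b' :
  unitary_basis K x a b -> unitary_basis K x a' b' ->
  exists p q, [/\ p * p + q * q = 1, a' = p *: a + q *: b
                & b' = (- q) *: a + p *: b].
Proof.
move=> uab [a'x -> a1 _]; have [ax bx aa bb ab] := unitary_met uab.
have [_ bJ _ span] := uab; have [p [q a'E]] := span _ a'x.
exists p, q; split=> //.
  have [Ma Mb] := met_coord p q uab.
  by rewrite -a1 {2}a'E metDr//; [rewrite metZr// a'E Ma Mb|exact: tangentZ].
rewrite bJ in bx; rewrite a'E bJ (cplx_linear K p ax (tangentZ q bx)).
rewrite (linear_onZ (cplx_linear K (x := x)) (tangent0 x) _ bx) cplx_sq//.
by rewrite scalerN scaleNr addrC.
Qed.

Lemma frame_unitary x a b : unitary_basis K x a b ->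
  unitary_basis K x (frame K x).1 (frame K x).2.
Proof. by move=> uab; rewrite /frame; case: xgetP => [ab _ //|/(_ (a, b))]. Qed.

(** The connection matrix of an orthonormal frame is skew-symmetric:
differentiate the constant functions [g(a,a)], [g(b,b)] and [g(a,b)]. *)
Lemma frame_derivative nab (lc : levi_civita K nab) x v (a b : M -> vec M) :
  tangent x v -> field_at a x -> field_at b x ->
  (\forall y \near x, unitary_basis K y (a y) (b y)) ->
  exists q, nab x v a = q *: b x /\ nab x v b = (- q) *: a x.
Proof.
move=> vx fa fb uab; have ux := nbhs_singleton uab.
have [ax bx aa bb ab] := unitary_met ux; have [_ _ _ span] := ux.
have ba : met K x (b x) (a x) = 0 by rewrite (met_sym K bx ax).
have [p [q Ea]] := span _ (lc_tangent lc vx fa).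
have [r [t Eb]] := span _ (lc_tangent lc vx fb).
have [Ma1 Ma2] := met_coord p q ux; have [Mb1 Mb2] := met_coord r t ux.
have nax := lc_tangent lc vx fa; have nbx := lc_tangent lc vx fb.
have Daa := lc_metric lc vx fa fa; have Dbb := lc_metric lc vx fb fb.
have Dab := lc_metric lc vx fa fb.
rewrite (tangent_near_cst (c := 1) vx) in Daa; last first.
  by apply: filterS uab => y /unitary_met[].
rewrite (tangent_near_cst (c := 1) vx) in Dbb; last first.
  by apply: filterS uab => y /unitary_met[].
rewrite (tangent_near_cst (c := 0) vx) in Dab; last first.
  by apply: filterS uab => y /unitary_met[].
rewrite (met_sym K ax nax) Ea Ma1 in Daa.
rewrite (met_sym K bx nbx) Eb Mb2 in Dbb.
rewrite (met_sym K ax nbx) Ea Eb Ma2 Mb1 in Dab.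
have p0 : p = 0 by lra.
have t0 : t = 0 by lra.
have rq : r = - q by lra.
by exists q; rewrite Ea Eb p0 t0 rq !scale0r add0r addr0.
Qed.

End UnitaryFrames.

(** * Ladder operators *)

Section Quantization.
Variable R : realType.
Implicit Types (f : R -> R[i]).

Lemma derive1_idM (h : R -> R) t : derivable h t 1 ->
  (fun u => u * h u)^`()%classic t = h t + t * h^`()%classic t.
Proof.
move=> dh; have di : derivable (@id R) t 1 by exact: derivable_id.
rewrite !derive1E [LHS](deriveM di dh) derive_id addrC.
by rewrite /GRing.scale/= mulr1.
Qed.

Lemma quant_commutator f : schwartz f ->
  quant_a (quant_b f) - quant_b (quant_a f) = - 'i%C *: f.
Proof.
move=> [[dr _] [di _]]; apply/funext => t.
have {}dr := dr 0 t; have {}di := di 0 t; rewrite /= in dr di.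
have Er u : complex.Re (quant_a f u) = - (u * complex.Im (f u)).
  by rewrite /quant_a; case: (f u) => x y; simpc.
have Ei u : complex.Im (quant_a f u) = u * complex.Re (f u).
  by rewrite /quant_a; case: (f u) => x y; simpc.
have dti : derivable (fun u : R => u * complex.Im (f u)) t 1.
  by have := derivableM (@derivable_id R R t 1) di.
transitivity (quant_a (quant_b f) t - quant_b (quant_a f) t) => //.
rewrite {2}/quant_b (funext Er) (funext Ei) (derive1_idM dr).
rewrite derive1E [X in (X +i* _)%C](deriveN dti) -derive1E (derive1_idM di).
rewrite [RHS](_ : _ = - 'i%C * f t)// /quant_a /quant_b.
move: (_^`()%classic t) (_^`()%classic t) => r s.
by case: (f t) => x y; simpc; congr (_ +i* _)%C => /=; ring.
Qed.
End Quantization.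

Section Ladder.
Variables (R : realType) (M : manifold R 2) (K : kahler M).
Variables (nab : M -> vec M -> (M -> vec M) -> vec M) (S : spinor_bundle K nab).
Implicit Types (x : M) (a b v : vec M) (j : R[i]).

(** Creation operator for [j = -i] and annihilation operator for [j = i], up to
a scalar. *)
Definition ladder j x a b (e : S x) : S x := act a e + j *: act b e.

Lemma actD x v (e e' : S x) : tangent x v ->
  act v (e + e') = act v e + act v e'.
Proof. by move=> vx; have := act_linear 1 e e' vx; rewrite !scale1r. Qed.

Lemma act0 x v : tangent x v -> act v 0 = 0 :> S x.
Proof.
move=> vx; have := actD (0 : S x) 0 vx; rewrite addr0.
exact: double_eq0.
Qed.

Lemma actZ x v (c : R[i]) (e : S x) : tangent x v ->
  act v (c *: e) = c *: act v e.
Proof. by move=> vx; have := act_linear c e 0 vx; rewrite act0// !addr0. Qed.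

Lemma act_comb x (p q : R) v w (e : S x) : tangent x v -> tangent x w ->
  act (p *: v + q *: w) e = p%:C%C *: act v e + q%:C%C *: act w e.
Proof.
move=> vx wx; have t0 := tangent0 x.
rewrite act_linear_vec//; last exact: tangentZ.
have := act_linear_vec 1 e t0 t0; rewrite !scale1r addr0 => /double_eq0 a0.
by have := act_linear_vec q e wx t0; rewrite a0 !addr0 => ->.
Qed.

Lemma ladder_lin j x a b (c : R[i]) (e e' : S x) : tangent x a -> tangent x b ->
  ladder j a b (c *: e + e') = c *: ladder j a b e + ladder j a b e'.
Proof.
move=> ax bx; rewrite /ladder !act_linear// !scalerDr !scalerA [j * c]mulrC.
by rewrite addrACA.
Qed.

Lemma ladderZ j x a b (c : R[i]) (e : S x) : tangent x a -> tangent x b ->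
  ladder j a b (c *: e) = c *: ladder j a b e.
Proof. by move=> ax bx; rewrite /ladder !actZ// scalerDr !scalerA mulrC. Qed.

Lemma ladderB j x a b (e e' : S x) : tangent x a -> tangent x b ->
  ladder j a b (e - e') = ladder j a b e - ladder j a b e'.
Proof.
by move=> ax bx; rewrite addrC -scaleN1r ladder_lin// scaleN1r addrC.
Qed.

Lemma ladder_rot j x a b (p q : R) (e : S x) : j * j = -1 ->
  tangent x a -> tangent x b ->
  ladder j (p *: a + q *: b) ((- q) *: a + p *: b) e =
  (p%:C%C - j * q%:C%C) *: ladder j a b e.
Proof.
move=> jj ax bx; rewrite /ladder !act_comb// !scalerDr addrACA !scalerA.
rewrite -!scalerDl; congr (_ *: _ + _ *: _); first by rewrite raddfN/=; ring.
by rewrite mulrBl mulrAC jj; ring.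
Qed.

(** The two factors are rotated by inverse scalars. *)
Lemma ladder_product_frame j x a b a' b' (e : S x) : j * j = -1 ->
  unitary_basis K x a b -> unitary_basis K x a' b' ->
  ladder j a' b' (ladder (- j) a' b' e) = ladder j a b (ladder (- j) a b e).
Proof.
move=> jj uab uab'; have [ax bx _ _ _] := unitary_met uab.
have [p [q [pq -> ->]]] := unitary_change uab uab'.
rewrite !ladder_rot// ?mulrNN// ladderZ// scalerA mulNr opprK.
by rewrite sum_sq_factor// pq scale1r.
Qed.

Lemma ladder_product j x a b (e : S x) : j * j = -1 ->
  tangent x a -> tangent x b ->
  ladder j a b (ladder (- j) a b e) =
  act a (act a e) + act b (act b e)
    - j *: (act a (act b e) - act b (act a e)).
Proof.
move=> jj ax bx; rewrite /ladder !actD// !actZ// !scalerDr !scalerA mulrN jj.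
rewrite opprK scale1r scalerN scaleNr opprB.
by rewrite addrACA [- _ + _]addrC addrACA.
Qed.

(** The sum of squares is half the sum of the products of ladder operators in
both orders, and those do not depend on the frame. *)
Lemma act_sq_frame x a b a' b' (e : S x) :
  unitary_basis K x a b -> unitary_basis K x a' b' ->
  act a' (act a' e) + act b' (act b' e) = act a (act a e) + act b (act b e).
Proof.
move=> uab uab'; have [ax bx _ _ _] := unitary_met uab.
have [a'x b'x _ _ _] := unitary_met uab'.
have ii := mulCii R.
have nii : - 'i%C * - 'i%C = -1 :> R[i] by rewrite mulrNN.
have sum2 u v : tangent x u -> tangent x v ->
    (act u (act u e) + act v (act v e)) *+ 2 =
    ladder 'i%C u v (ladder (- 'i%C) u v e)
    + ladder (- 'i%C) u v (ladder 'i%C u v e).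
  move=> ux vx; rewrite ladder_product// -[X in ladder X u v e]opprK.
  rewrite ladder_product// scaleNr opprK addrACA addNr addr0.
  by rewrite mulr2n.
apply: (@scalerI _ _ (2%:R : R[i])); first by rewrite pnatr_eq0.
rewrite !scaler_nat !sum2// (ladder_product_frame _ ii uab uab').
by have := ladder_product_frame e nii uab uab'; rewrite opprK => ->.
Qed.

Lemma act_commutator x : exists a b, unitary_basis K x a b /\
  forall e : S x, act a (act b e) - act b (act a e) = - 'i%C *: e.
Proof.
have [a [b [F [Phi [_ _ [FS _ _ _] nx _]]]]] := spb_local S x.
have [uab lPhi [PhiF Phi_inj _] Pa Pb] := nbhs_singleton nx.
exists (a x), (b x); split=> // e; apply: Phi_inj; rewrite ?inE//.
have PhiB (u v : S x) : Phi x (u - v) = Phi x u - Phi x v.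
  by rewrite addrC -scaleN1r lPhi// scaleN1r addrC.
rewrite PhiB !(Pa, Pb) quant_commutator; last by apply: FS; apply: PhiF.
by rewrite (linear_onZ lPhi).
Qed.

(** Neither side depends on the unitary frame, so it is enough to consider the
one in which the representation is the canonical quantization. *)
Lemma ladder_product_hamiltonian j x a b (e : S x) :
  j * j = -1 -> unitary_basis K x a b ->
  ladder j a b (ladder (- j) a b e) = 2%:R *: hamiltonian e + (j * 'i%C) *: e.
Proof.
move=> jj uab; have [a' [b' [uab' cab]]] := act_commutator x.
have [a'x b'x _ _ _] := unitary_met uab'.
rewrite (ladder_product_frame e jj uab' uab) ladder_product// cab.
rewrite scaleNr scalerN opprK scalerA; congr (_ + _).
have := frame_unitary uab.
rewrite /hamiltonian; case: (frame K x) => u v /= uuv.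
rewrite scalerA divff ?pnatr_eq0// scale1r.
exact: act_sq_frame.
Qed.

End Ladder.

(** * Eigenbundles of the Hamiltonian *)

Section Eigenbundles.
Variables (R : realType) (M : manifold R 2) (K : kahler M).
Variables (nab : M -> vec M -> (M -> vec M) -> vec M) (S : spinor_bundle K nab).
Implicit Types (x : M) (a b v w : vec M) (j lambda : R[i]).
Implicit Types (s t : forall x, S x).

Definition eigen lambda x : set (S x) :=
  [set e | hamiltonian e = lambda *: e].

Lemma unitary_frame_near x : exists a b : M -> vec M,
  [/\ field_at a x, field_at b x
    & \forall y \near x, unitary_basis K y (a y) (b y)].
Proof.
have [a [b [F [Phi [fa fb _ nx _]]]]] := spb_local S x.
by exists a, b; split=> //; apply: filterS nx => y [].
Qed.

Lemma eigen_ladder j x a b lambda (e : S x) : j * j = -1 ->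
  unitary_basis K x a b ->
  eigen lambda e <->
  ladder j a b (ladder (- j) a b e) = (2%:R * lambda + j * 'i%C) *: e.
Proof.
move=> jj uab; rewrite /eigen/= ladder_product_hamiltonian// scalerDl.
rewrite -(scalerA 2%:R).
split=> [->//|/addIr]; apply: (@scalerI _ _ (2%:R : R[i])).
by rewrite pnatr_eq0.
Qed.

(** [L_j (L_(-j) L_j) = (L_j L_(-j)) L_j], where [L_(-j) L_j] acts on [e] by the
scalar [2 lambda - j i]. *)
Lemma ladder_eigen j x a b lambda (e : S x) : j * j = -1 ->
  unitary_basis K x a b -> eigen lambda e ->
  eigen (lambda - j * 'i%C) (ladder j a b e).
Proof.
move=> jj uab; have [ax bx _ _ _] := unitary_met uab.
have njj : - j * - j = -1 by rewrite mulrNN.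
move/(eigen_ladder _ _ njj uab); rewrite opprK => E.
apply/(eigen_ladder _ _ jj uab); rewrite E ladderZ//; congr (_ *: _); ring.
Qed.

Lemma eigen_lin lambda x (c : R[i]) (e e' : S x) :
  eigen lambda e -> eigen lambda e' -> eigen lambda (c *: e + e').
Proof.
have ii := mulCii R.
have [a [b [_ _ /nbhs_singleton uab]]] := unitary_frame_near x.
have [ax bx _ _ _] := unitary_met uab.
move=> /(eigen_ladder _ _ ii uab) E /(eigen_ladder _ _ ii uab) E'.
apply/(eigen_ladder _ _ ii uab); rewrite !ladder_lin// E E' scalerDr !scalerA.
by rewrite mulrC.
Qed.

(** Extend by the section with the same image as [e] in a local trivialization.
The trivialization intertwines the ladder operators with fixed operators on
functions of one variable, so being an eigenvector passes from the fibre at [x]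
to nearby fibres. *)
Lemma spinor_extension lambda x (e : S x) : eigen lambda e ->
  exists2 s, section_at (eigen lambda) x s & s x = e.
Proof.
move=> Ee; have [a [b [F [Phi [_ _ _ nx smooth_const]]]]] := spb_local S x.
have [_ _ [PhiF Phi_inj _] _ _] := nbhs_singleton nx.
have Ff : F (Phi x e) by exact: PhiF.
pose s y : S y := xget 0 [set e' | Phi y e' = Phi x e].
have ns : \forall y \near x, Phi y (s y) = Phi x e.
  apply: filterS nx => y [_ _ [_ _ Phi_surj] _ _].
  have [e' _ Ee'] := Phi_surj _ Ff.
  by rewrite /s; case: xgetP => [e'' _ //|/(_ e')].
exists s; last by apply: Phi_inj; rewrite ?inE//; exact: nbhs_singleton ns.
split; first exact: smooth_const Ff ns.
have ii := mulCii R.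
have [ux lx _ Pax Pbx] := nbhs_singleton nx.
have /(eigen_ladder _ _ ii ux) Lx := Ee.
near=> y.
have [uy ly [_ inj_y _] Pay Pby] : [/\ unitary_basis K y (a y) (b y),
  linear_on setT (Phi y), set_bij setT F (Phi y),
  forall p, Phi y (act (a y) p) = quant_a (Phi y p)
  & forall p, Phi y (act (b y) p) = quant_b (Phi y p)] by near: y.
have Ey : Phi y (s y) = Phi x e by near: y.
apply/(eigen_ladder _ _ ii uy); apply: inj_y; rewrite ?inE//.
have PL z (lz : linear_on setT (Phi z))
  (Pa : forall p, Phi z (act (a z) p) = quant_a (Phi z p))
  (Pb : forall p, Phi z (act (b z) p) = quant_b (Phi z p)) j p :
  Phi z (ladder j (a z) (b z) p) = quant_a (Phi z p) + j *: quant_b (Phi z p).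
  by rewrite /ladder addrC lz// Pa Pb addrC.
have PLx := PL x lx Pax Pbx; have PLy := PL y ly Pay Pby.
rewrite (linear_onZ ly)// Ey -(linear_onZ lx)// -Lx.
by rewrite PLy PLy Ey PLx PLx.
Unshelve. all: by end_near.
Qed.

End Eigenbundles.

(** * The Dolbeault operators *)

Section Dolbeault.
Variables (R : realType) (M : manifold R 2) (K : kahler M).
Variables (nab : M -> vec M -> (M -> vec M) -> vec M) (S : spinor_bundle K nab).
Hypothesis lc : levi_civita K nab.
Implicit Types (x : M) (a b v w : vec M) (j lambda : R[i]).
Implicit Types (s t : forall x, S x).

Lemma smooth_cst_scale x (c : R[i]) s :
  smooth_sec x s -> smooth_sec x (fun y => c *: s y).
Proof.
by move=> ss; apply: (sec_scale (f := fun=> c)) => //; exact: csmooth_at_cst.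
Qed.

Lemma smooth_rscale x (f : M -> R) s :
  smooth_at f x -> smooth_sec x s -> smooth_sec x (rscale f s).
Proof. by move=> sf ss; apply: sec_scale => //; exact: csmooth_at_real. Qed.

Lemma smooth_ladder j x (a b : M -> vec M) s : field_at a x -> field_at b x ->
  smooth_sec x s -> smooth_sec x (fun y => ladder j (a y) (b y) (s y)).
Proof.
move=> fa fb ss; apply: sec_add; first exact: act_smooth.
by apply: smooth_cst_scale; exact: act_smooth.
Qed.

Lemma nabS_scale x v (c : R[i]) s : tangent x v -> smooth_sec x s ->
  nabS x v (fun y => c *: s y) = c *: nabS x v s.
Proof.
move=> vx ss; rewrite (nabS_leibniz vx (csmooth_at_cst c x) ss).
by rewrite /cder !(tangent_cst _ vx) scale0r add0r.
Qed.

Lemma nabS_rscale x v (f : M -> R) s : tangent x v -> smooth_at f x ->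
  smooth_sec x s ->
  nabS x v (rscale f s) = (v f)%:C%C *: s x + (f x)%:C%C *: nabS x v s.
Proof.
move=> vx sf ss; rewrite [LHS](nabS_leibniz vx (csmooth_at_real sf) ss).
by rewrite /cder/= (tangent_cst _ vx).
Qed.

Lemma nabS_comb x (p q : R) v w s : tangent x v -> tangent x w ->
  smooth_sec x s ->
  nabS x (p *: v + q *: w) s = p%:C%C *: nabS x v s + q%:C%C *: nabS x w s.
Proof.
move=> vx wx ss; have t0 := tangent0 x.
rewrite nabS_linear_vec//; last exact: tangentZ.
have := nabS_linear_vec 1 t0 t0 ss; rewrite !scale1r addr0 => /double_eq0 n0.
by have := nabS_linear_vec q wx t0 ss; rewrite n0 !addr0 => ->.
Qed.

(** With [nabla_v a = q b] and [nabla_v b = -q a], differentiating the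
coefficients of [L_j] gives [q (act b - j act a) = - j q L_j].  The coefficient
[q] is the same for both values of [j]. *)
Lemma nabS_ladder x v (a b : M -> vec M) :
  tangent x v -> field_at a x -> field_at b x ->
  (\forall y \near x, unitary_basis K y (a y) (b y)) ->
  exists q : R, forall j s, j * j = -1 -> smooth_sec x s ->
    nabS x v (fun y => ladder j (a y) (b y) (s y)) =
    ladder j (a x) (b x) (nabS x v s)
      - (j * q%:C%C) *: ladder j (a x) (b x) (s x).
Proof.
move=> vx fa fb uab; have [q [na nb]] := frame_derivative lc vx fa fb uab.
have [ax bx _ _ _] := unitary_met (nbhs_singleton uab).
exists q => j s jj ss.
have sA := act_smooth fa ss; have sB := act_smooth fb ss.
rewrite [LHS](nabS_add vx sA (smooth_cst_scale j sB)) nabS_scale//.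
rewrite !act_nabS// na nb -ladderZ// -ladderB// /ladder.
have := act_comb 0 q (s x) ax bx; rewrite !scale0r !add0r => ->.
have := act_comb (- q) 0 (s x) ax bx; rewrite !scale0r !addr0 => ->.
rewrite -scaleNr !actD// !actZ// !scalerDr !scalerA.
rewrite [_ + act _ (nabS _ _ _)]addrC addrACA [q%:C%C *: _ + _]addrC.
congr (_ + _ *: _ + (_ + _ *: _)); first by rewrite raddfN/=; ring.
by rewrite mulrN mulrA jj mulN1r opprK.
Qed.

Lemma section_near x (E : forall x, set (S x)) s : section_at E x s ->
  \forall y \near x, section_at E y s.
Proof.
move=> [ss Es]; have := nbhs_interior Es; apply: filterS2 (sec_near ss) => y.
by [].
Qed.

(** The connection preserves the eigenbundles: it commutes with [L_j L_(-j)], as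
its commutators with the two factors cancel. *)
Lemma nabS_eigen x v lambda s : tangent x v -> section_at (eigen lambda) x s ->
  eigen lambda (nabS x v s).
Proof.
move=> vx [ss Es]; have [a [b [fa fb uab]]] := unitary_frame_near S x.
have ux := nbhs_singleton uab; have [ax bx _ _ _] := unitary_met ux.
have ii := mulCii R.
have nii : - 'i%C * - 'i%C = -1 :> R[i] by rewrite mulrNN.
apply/(eigen_ladder _ _ ii ux); set k := _ + _.
have [q nabL] := nabS_ladder vx fa fb uab.
have sL := smooth_ladder (- 'i%C) fa fb ss.
have sLL := smooth_ladder 'i%C fa fb sL.
have <- : nabS x v (fun y => ladder 'i%C (a y) (b y)
    (ladder (- 'i%C) (a y) (b y) (s y))) = k *: nabS x v s.
  rewrite -nabS_scale//; apply: nabS_local => //.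
  apply: filterS2 uab Es => y uy Ey.
  by rewrite /k; apply/(eigen_ladder _ _ ii uy).
rewrite (nabL _ _ ii sL) (nabL _ _ nii ss).
by rewrite ladderB// ladderZ// mulNr scaleNr opprK addrK.
Qed.

(** Both Dolbeault operators at once: [j = i] and [j = -i]. *)
Definition twisted_dirac j s x : S x := Defs.dirac s x + j *: dirac_tilde s x.

(** Over the chosen frame this is an expansion using [j * j = -1]; passing to
[a], [b] rotates the two factors by inverse scalars. *)
Lemma twisted_dirac_frame j x a b s : j * j = -1 -> unitary_basis K x a b ->
  smooth_sec x s ->
  twisted_dirac j s x = ladder j a b (nabS x b s + j *: nabS x a s).
Proof.
move=> jj uab ss; have [ax bx _ _ _] := unitary_met uab.
have := frame_unitary uab.
rewrite /twisted_dirac /Defs.dirac /dirac_tilde.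
case: (frame K x) => u v /= uuv.
have [ux vx _ _ _] := unitary_met uuv.
transitivity (ladder j u v (nabS x v s + j *: nabS x u s)).
  rewrite /ladder !actD// !actZ// !scalerDr !scalerA jj scaleN1r.
  by rewrite addrACA [- _ + _]addrC.
have [p [q [pq uE vE]]] := unitary_change uab uuv.
have -> : nabS x v s + j *: nabS x u s =
    (p%:C%C + j * q%:C%C) *: (nabS x b s + j *: nabS x a s).
  rewrite uE vE !nabS_comb// !scalerDr addrC addrACA !scalerA -!scalerDl addrC.
  congr (_ *: _ + _ *: _); first by ring.
  rewrite raddfN/= mulrDl [j * _ * j]mulrAC jj; ring.
rewrite uE vE ladder_rot// ladderZ// scalerA sum_sq_factor//.
by rewrite pq scale1r.
Qed.

(** The principal symbol of [D + j D~] at the covector with value [alpha] at [a]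
and [beta] at [b]. *)
Definition symbol j x a b (alpha beta : R) (e : S x) : S x :=
  (beta%:C%C + j * alpha%:C%C) *: ladder j a b e.

Lemma twisted_dirac_rscale j x a b (f : M -> R) s : j * j = -1 ->
  unitary_basis K x a b -> smooth_at f x -> smooth_sec x s ->
  twisted_dirac j (rscale f s) x =
  symbol j a b (a f) (b f) (s x) + (f x)%:C%C *: twisted_dirac j s x.
Proof.
move=> jj uab sf ss; have [ax bx _ _ _] := unitary_met uab.
have sfs := smooth_rscale sf ss.
rewrite !(twisted_dirac_frame jj uab)// !nabS_rscale// /symbol -!ladderZ//.
rewrite scalerDr addrACA !scalerA -scalerDl [j * (f x)%:C%C]mulrC.
rewrite -scalerA -scalerDr.
by rewrite -[X in ladder _ _ _ (X + _)]scale1r ladder_lin// scale1r.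
Qed.

(** The Leibniz formula makes every commutator with a function the zeroth order
operator [symbol], which commutes with functions. *)
Lemma twisted_dirac_diffop j lambda : j * j = -1 ->
  diffop1 (twisted_dirac j) (eigen lambda) (eigen (lambda - j * 'i%C)).
Proof.
move=> jj x s sE; have [ss Es] := sE.
have [a [b [fa fb uab]]] := unitary_frame_near S x.
have ux := nbhs_singleton uab; have [ax bx _ _ _] := unitary_met ux.
have nwE : \forall y \near x, twisted_dirac j s y =
    ladder j (a y) (b y) (nabS y (b y) s + j *: nabS y (a y) s).
  by apply: filterS2 uab (sec_near ss) => y uy sy; exact: twisted_dirac_frame.
split.
- split.
    apply: (sec_local _ (filterS (fun y => esym) nwE)).
    apply: smooth_ladder => //; apply: sec_add; first exact: nabS_smooth.
    by apply: smooth_cst_scale; exact: nabS_smooth.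
  near=> y.
  have sEy : section_at (eigen lambda) y s by near: y; exact: section_near.
  have uy : unitary_basis K y (a y) (b y) by near: y.
  have [ay by_ _ _ _] := unitary_met uy.
  have -> : twisted_dirac j s y =
      ladder j (a y) (b y) (nabS y (b y) s + j *: nabS y (a y) s) by near: y.
  apply: ladder_eigen => //.
  rewrite addrC; apply: eigen_lin; exact: nabS_eigen.
- move=> t st; rewrite !(twisted_dirac_frame jj ux)//; last exact: sec_local st.
  by rewrite (nabS_local ax ss st) (nabS_local bx ss st).
- move=> c t [st _].
  have scs := smooth_cst_scale c ss.
  rewrite !(twisted_dirac_frame jj ux)//; last exact: sec_add.
  rewrite -ladder_lin//; congr ladder.
  rewrite !nabS_add// !nabS_scale// !scalerDr !scalerA [j * c]mulrC.
  by rewrite addrACA.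
- move=> f g sf sg; have sgs := smooth_rscale sg ss.
  rewrite /commutator !(twisted_dirac_rscale jj ux sf)//.
  rewrite !addrK /symbol /rscale !ladderZ// !scalerA mulrC.
Unshelve. all: by end_near.
Qed.

(** On the two eigenspaces [L_(-j) L_j] and [L_j L_(-j)] are multiplication by
the same scalar [2 lambda - j i], so the symbol is bijective when that scalar is
nonzero. *)
Lemma twisted_dirac_elliptic j lambda :
  j * j = -1 -> 2%:R * lambda - j * 'i%C != 0 ->
  elliptic (twisted_dirac j) (eigen lambda) (eigen (lambda - j * 'i%C)).
Proof.
move=> jj nz; split; first exact: twisted_dirac_diffop.
move=> x xi lxi [v vx xiv].
have njj : - j * - j = -1 by rewrite mulrNN.
have [a [b uab]] : exists a b, unitary_basis K x a b.
  have [a [b [_ _ /nbhs_singleton uab]]] := unitary_frame_near S x.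
  by exists (a x), (b x).
have [ax bx _ _ _] := unitary_met uab.
pose kappa := (xi b)%:C%C + j * (xi a)%:C%C.
(* [xi] is real: [xi(b)^2 + xi(a)^2 = 0] would force [xi = 0] *)
have k0 : kappa != 0.
  apply: contra_notN xiv => /eqP k0.
  have := sum_sq_factor (xi b) (xi a) jj; rewrite -/kappa k0 mulr0.
  move/esym/eqP; rewrite fmorph_eq0 -!expr2 paddr_eq0 ?sqr_ge0// !sqrf_eq0.
  move=> /andP[/eqP b0 /eqP a0].
  have [_ _ _ span] := uab; have [p [q ->]] := span _ vx.
  rewrite (lxi _ _ _ ax (tangentZ q bx)).
  by rewrite (linear_onZ lxi (tangent0 x) _ bx) a0 b0 !scaler0 addr0.
have down (e : S x) : eigen lambda e ->
    ladder (- j) a b (ladder j a b e) = (2%:R * lambda - j * 'i%C) *: e.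
  by move/(eigen_ladder _ _ njj uab); rewrite opprK mulNr.
have up (e : S x) : eigen (lambda - j * 'i%C) e ->
    ladder j a b (ladder (- j) a b e) = (2%:R * lambda - j * 'i%C) *: e.
  move/(eigen_ladder _ _ jj uab) => ->; congr (_ *: _); ring.
have eigenZ l c (e : S x) : eigen l e -> eigen l (c *: e).
  move=> Ee; have := eigen_lin (c - 1) Ee Ee.
  by rewrite scalerBl scale1r subrK.
exists (symbol j a b (xi a) (xi b)); split.
- move=> c e e' _ _; rewrite /symbol ladder_lin// scalerDr !scalerA.
  by rewrite [c * _]mulrC.
- split.
  + by move=> e Ee; apply: eigenZ; exact: ladder_eigen.
  + move=> e e' /set_mem/down De /set_mem/down De' /(scalerI k0) L.
    by apply: (scalerI nz); rewrite -De -De' L.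
  + move=> e Ee; exists (kappa^-1 *: ((2%:R * lambda - j * 'i%C)^-1 *:
      ladder (- j) a b e)).
      apply/eigenZ/eigenZ.
      by have := ladder_eigen njj uab Ee; rewrite mulNr opprK subrK.
    rewrite /symbol !ladderZ// up// scalerA divff// scale1r.
    by rewrite scalerA mulVf// scale1r.
- move=> e e'; split.
    move=> [f [s [sf fx dfx [ss Es] [<- <-]]]].
    split; first exact: nbhs_singleton Es.
    by rewrite (twisted_dirac_rscale jj uab)// fx scale0r addr0 !dfx.
  move=> [Ee ->]; have [a0 ba] := unitary_indep uab.
  have [f [sf fx fa fb]] := differential_onto (xi a) (xi b) ax bx a0 ba.
  have [s sE sx] := spinor_extension Ee; have [ss _] := sE.
  exists f, s; split=> //; last first.
    split=> //; rewrite (twisted_dirac_rscale jj uab)// fx scale0r addr0.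
    by rewrite fa fb sx.
  move=> w wx; have [_ _ _ span] := uab; have [p [q ->]] := span _ wx.
  rewrite (lxi _ _ _ ax (tangentZ q bx)).
  by rewrite (linear_onZ lxi (tangent0 x) _ bx) -fa -fb.
Qed.

End Dolbeault.

Theorem proposition3p1 (R : realType) (M : manifold R 2) (K : kahler M)
    (nab : M -> vec M -> (M -> vec M) -> vec M)
    (S : spinor_bundle K nab) :
  compact [set: M]%classic ->
  levi_civita K nab ->
  spinor_decomposition S ->
  (forall l : nat,
     elliptic (dolbeault_bar S) (eigenbundle S l)
              (eigenbundle S l.+1)) /\
  (forall l : nat, (1 <= l)%N ->
     elliptic (dolbeault S) (eigenbundle S l) (eigenbundle S l.-1)).
Proof.
move=> _ lc _; have ii := mulCii R.
split=> [l|[//|l] _].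
- have -> : dolbeault_bar S = twisted_dirac (- 'i%C).
    apply/funext => s; apply: functional_extensionality_dep => x.
    by rewrite /twisted_dirac scaleNr.
  have := @twisted_dirac_elliptic _ _ _ _ S lc (- 'i%C) (- (l%:R + 2%:R^-1)).
  rewrite mulrNN mulNr opprK ii => /(_ erefl).
  rewrite (_ : - (l%:R + 2^-1) + -1 = - (l.+1%:R + 2^-1)); last first.
    by rewrite -natr1; ring.
  apply; rewrite [X in X != _](_ : _ = - (l.+1 * 2)%:R).
    by rewrite oppr_eq0 pnatr_eq0.
  by rewrite natrM -natr1; field.
- have := @twisted_dirac_elliptic _ _ _ _ S lc 'i%C (- (l.+1%:R + 2%:R^-1)).
  rewrite ii opprK => /(_ erefl).
  rewrite (_ : - (l.+1%:R + 2^-1) + 1 = - (l%:R + 2^-1)); last first.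
    by rewrite -natr1; ring.
  apply; rewrite [X in X != _](_ : _ = - (l.+1 * 2)%:R).
    by rewrite oppr_eq0 pnatr_eq0.
  by rewrite natrM -natr1; field.
Qed.
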